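(* There is no stationary probability measure on $\mathbf{\Gamma}_{\bullet}$ that induces a measure on $\mathbf{\Gamma}^{\dagger}_{\bullet}$ that is absolutely continuous with respect to some stationary probability measure on $\mathbf{\Gamma}^{\dagger}_{\bullet}$. That is: if $\mu$ is a probability measure on $\mathbf{\Gamma}_{\bullet}$ that is stationary for simple random walk, and $\nu$ is the probability measure on $\mathbf{\Gamma}^{\dagger}_{\bullet}$ that is induced by $\mu$ (by choosing uniformly at random a face incident to the root as the root of the dual), then $\nu$ is not absolutely continuous with respect to any probability measure on $\mathbf{\Gamma}^{\dagger}_{\bullet}$ that is stationary for simple random walk.
   Context: $\mathbb{Z}_2$ denotes the dyadic ($2$-adic) integers, identified with left-infinite binary strings $a=(a_k)_{k\le 0}=\sum_{k\le 0}a_k2^{-k}$, $a_k\in\{0,1\}$, so $a_0$ is the units digit. Let $\mathbf{\Gamma}$ be the graph on $\mathbb{Z}\times\mathbb{Z}_2$ with edges between $(m,b)$ and $(m,b\pm1)$ (horizontal) and between $(m,b)$ and $(m+1,2b)$ (vertical; multiplication by $2$ is the operation of appending a terminal $0$). The depth of $(m,b)$ is $m$. $\Gamma_a$ is the connected component of $(0,a)$, rooted at $(0,a)$, with its planar embedding in which the edges from $(0,a)$ to $(0,a-1)$, $(1,2a)$, $(0,a+1)$, in that order, are positively oriented. The set of these rooted embedded graphs, $\mathbf{\Gamma}_{\bullet}=\{\Gamma_a : a\in\mathbb{Z}_2\}$, is identified with $\mathbb{Z}_2$ via $\Gamma_a\leftrightarrow a$. Simple random walk on $\mathbf{\Gamma}_{\bullet}$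 (moving the root to a uniformly random neighbour) is the Markov chain on $\mathbb{Z}_2$ which from $a$ moves to one of $a+1$, $a-1$, $2a$, and, if $a$ is even, also $a/2$, chosen uniformly among the three (if $a$ is odd) or four (if $a$ is even) options. Every bounded face of $\Gamma_a$ has five edges: one each on top, left and right, and two on the bottom. $\mathbf{\Gamma}^{\dagger}_{\bullet}$ is the collection of oriented rooted plane graphs dual to the $\Gamma_a$, rooted at a face. It is also coded by $\mathbb{Z}_2$: a face is labelled by the dyadic integer labelling the vertex at its upper left corner, and a rooted dual graph is coded by the label of its root face. With this coding, simple random walk on $\mathbf{\Gamma}^{\dagger}_{\bullet}$ is the Markov chain on $\mathbb{Z}_2$ which from $c$ moves, with probability $1/5$ each, to $c+1$, $c-1$, $(c-c_0)/2$ (remove the last bit $c_0$), $2c$, or $2c+1$. Induced measure: given $\mu$ on $\mathbf{\Gamma}_{\bullet}$, choose $\Gamma_a$ with law $\mu$ and then choose uniformly at random one of the faces of $\Gamma_a$ incident to the root; $\nu$ is the law of the dual graph rooted at this face. In terms of codes, the labels of the faces incident to the root of $\Gamma_a$ are $a,\ a-1,\ (a-1)/2$ if $a$ is odd, and $a,\ a-1,\ a/2,\ a/2-1$ if $a$ is even. A stationary measure on $\mathbf{\Gamma}_{\bullet}$ or $\mathbf{\Gamma}^{\dagger}_{\bullet}$ means a (Borel) probability measure on $\mathbb{Z}_2$ that is stationary for the corresponding Markov chain. *)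

(* Defs.v *)
From HB Require Import structures.
From mathcomp Require Import all_boot all_order all_algebra.
From mathcomp Require Import zify.
From mathcomp Require Import all_classical all_reals all_analysis.
From mathcomp Require Import measurable_realfun.

Set Implicit Arguments.
Unset Strict Implicit.
Unset Printing Implicit Defensive.

Import Order.TTheory GRing.Theory Num.Theory.
Import numFieldNormedType.Exports.

Local Open Scope classical_set_scope.
Local Open Scope ring_scope.

(* A dyadic integer is the sequence of its binary digits: a k : bool is the
   coefficient of 2 ^ k, i.e. the digit written a_{-k} when the string is
   indexed by the nonpositive integers; a 0 is the units digit. The topology
   is the product topology, and measurable means Borel. *)
Definition dyadic : Type := cantor_space.

HB.instance Definition _ := Pointed.on dyadic.
HB.instance Definition _ := Topological.on dyadic.
HB.instance Definition _ :=
  Measurable.copy dyadic (g_sigma_algebraType (@open cantor_space)).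

Definition dy_odd (a : dyadic) : bool := a 0%N.

(* a + 1: the carry reaches digit k iff all lower digits are 1 *)
Definition dy_succ (a : dyadic) : dyadic :=
  fun k => a k (+) [forall j : 'I_k, a j].

(* a - 1: the borrow reaches digit k iff all lower digits are 0 *)
Definition dy_pred (a : dyadic) : dyadic :=
  fun k => a k (+) [forall j : 'I_k, ~~ a j].

Definition dy_double (a : dyadic) : dyadic :=
  fun k => if k is j.+1 then a j else false.

(* (a - a_0) / 2 *)
Definition dy_half (a : dyadic) : dyadic := fun k => a k.+1.

(* The arithmetic above is that of Z_2: it is characterized by its effect on
   the residues modulo 2 ^ n. *)
Definition dy_residue (a : dyadic) (n : nat) : nat :=
  (\sum_(i < n) a i * 2 ^ i)%N.

Lemma dy_residueS a n : dy_residue a n.+1 = (dy_residue a n + a n * 2 ^ n)%N.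
Proof. by rewrite /dy_residue big_ord_recr. Qed.

Lemma forall_ordS n (P : pred nat) :
  [forall j : 'I_n.+1, P j] = [forall j : 'I_n, P j] && P n.
Proof.
apply/forallP/andP => [h|[/forallP h Pn] j].
  split; last exact: (h ord_max).
  by apply/forallP => j; exact: (h (widen_ord (leqnSn n) j)).
have [jn|nj] := ltnP j n; first exact: (h (Ordinal jn)).
by have -> : nat_of_ord j = n by apply/eqP; rewrite eqn_leq nj -ltnS ltn_ord.
Qed.

Lemma dy_residue_succ a n :
  dy_residue (dy_succ a) n = (dy_residue a n + 1)%N %[mod 2 ^ n].
Proof.
suff -> : (dy_residue a n + 1 =
    dy_residue (dy_succ a) n + [forall j : 'I_n, a j] * 2 ^ n)%N.
  by rewrite addnC modnMDl.
elim: n => [|n IH].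
  rewrite /dy_residue !big_ord0.
  by have -> : [forall j : 'I_0, a j] by apply/forallP => -[].
rewrite !dy_residueS forall_ordS addnAC IH /dy_succ expnS.
by case: (a n); case: [forall j : 'I_n, a j] => /=; lia.
Qed.

Lemma dy_residue_pred a n :
  (dy_residue (dy_pred a) n + 1)%N = dy_residue a n %[mod 2 ^ n].
Proof.
suff -> : (dy_residue (dy_pred a) n + 1 =
    dy_residue a n + [forall j : 'I_n, ~~ a j] * 2 ^ n)%N.
  by rewrite addnC modnMDl.
elim: n => [|n IH].
  rewrite /dy_residue !big_ord0.
  by have -> : [forall j : 'I_0, ~~ a j] by apply/forallP => -[].
rewrite !dy_residueS (forall_ordS n (fun j => ~~ a j)) addnAC IH /dy_pred expnS.
by case: (a n); case: [forall j : 'I_n, ~~ a j] => /=; lia.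
Qed.

Lemma dy_residue_double a n :
  dy_residue (dy_double a) n.+1 = (2 * dy_residue a n)%N.
Proof.
rewrite /dy_residue big_ord_recl /= mul0n add0n big_distrr /=.
by apply: eq_bigr => i _; rewrite expnS mulnCA.
Qed.

Lemma dy_residue_half a n :
  dy_residue a n.+1 = (dy_odd a + 2 * dy_residue (dy_half a) n)%N.
Proof.
rewrite /dy_residue big_ord_recl /= expn0 muln1 big_distrr /=; congr addn.
by apply: eq_bigr => i _; rewrite /bump leq0n add1n expnS mulnCA.
Qed.

(* The rooted graph Gamma_a is coded by the label a of its root, and a rooted
   dual graph by the label of its root face, a face being labelled by its upper
   left corner. Entries are listed with multiplicity, since
   distinct neighbours may have the same label (2 * 0 and 0 / 2, for instance). *)
Definition graph_neighbours (a : dyadic) : seq dyadic :=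
  if dy_odd a then [:: dy_succ a; dy_pred a; dy_double a]
  else [:: dy_succ a; dy_pred a; dy_double a; dy_half a].

Definition dual_neighbours (c : dyadic) : seq dyadic :=
  [:: dy_succ c; dy_pred c; dy_half c; dy_double c; dy_succ (dy_double c)].

(* A face with upper left corner (m, b) has the five corners (m, b), (m, b + 1),
   (m + 1, 2 b), (m + 1, 2 b + 1), (m + 1, 2 b + 2); these are the labels b of
   the faces having the root a as a corner. *)
Definition incident_faces (a : dyadic) : seq dyadic :=
  if dy_odd a then [:: a; dy_pred a; dy_half (dy_pred a)]
  else [:: a; dy_pred a; dy_half a; dy_pred (dy_half a)].

Lemma graph_neighbours_size a : (0 < size (graph_neighbours a))%N.
Proof. by rewrite /graph_neighbours; case: ifP. Qed.

Lemma dual_neighbours_size c : (0 < size (dual_neighbours c))%N.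
Proof. by []. Qed.

Lemma incident_faces_size a : (0 < size (incident_faces a))%N.
Proof. by rewrite /incident_faces; case: ifP. Qed.

Local Open Scope ereal_scope.

Section uniform_choice.
Context d (T : measurableType d) (R : realType).
Implicit Type s : seq T.

Definition uniform_choice s (A : set T) : \bar R :=
  ((size s)%:R^-1)%:E * \sum_(x <- s) \d_x A.

Let uniform_choice0 s : uniform_choice s set0 = 0.
Proof. by rewrite /uniform_choice big1 ?mule0// => x _; rewrite measure0. Qed.

Let uniform_choice_ge0 s A : 0 <= uniform_choice s A.
Proof.
by apply: mule_ge0; [rewrite lee_fin invr_ge0|exact: sume_ge0].
Qed.

Let uniform_choice_sigma_additive s : semi_sigma_additive (uniform_choice s).
Proof.
move=> F mF tF mUF; rewrite /uniform_choice.
have -> : (fun n => \sum_(0 <= i < n)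
    ((size s)%:R^-1%:E * \sum_(x <- s) (\d_x (F i) : \bar R))) =
  (fun n => (size s)%:R^-1%:E * \sum_(x <- s) \sum_(0 <= i < n) \d_x (F i)).
  apply/funext => n; rewrite exchange_big/= ge0_sume_distrr//.
  by move=> i _; exact: sume_ge0.
apply: cvgeZl => //.
elim: s => [|x s IH].
  rewrite big_nil; under eq_fun do rewrite big_nil; exact: cvg_cst.
rewrite big_cons; under eq_fun do rewrite big_cons.
apply: cvgeD => //.
exact: (@measure_semi_sigma_additive _ _ _ (\d_x)).
Qed.

HB.instance Definition _ s := isMeasure.Build d T R (uniform_choice s)
  (uniform_choice0 s) (uniform_choice_ge0 s)
  (@uniform_choice_sigma_additive s).

Lemma uniform_choice_setT s : (0 < size s)%N -> uniform_choice s setT = 1.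
Proof.
move=> s0; rewrite /uniform_choice.
under eq_bigr do rewrite diracT.
rewrite -(big_map (fun=> 1) xpredT id) big_map sumEFin.
by rewrite big_const_seq count_predT iter_addr_0 -EFinM mulVf// pnatr_eq0 -lt0n.
Qed.

End uniform_choice.
Arguments uniform_choice {d T R}.

(* Law of the state reached by the kernel k from an initial state of law mu *)
Section one_step.
Context d d' (X : measurableType d) (Y : measurableType d') (R : realType).
Variables (k : R.-pker X ~> Y) (mu : probability X R).

Definition one_step (A : set Y) : \bar R := \int[mu]_x k x A.

Let step0 : one_step set0 = 0.
Proof.
rewrite /one_step (eq_integral (cst 0)) ?integral0// => x _.
by rewrite measure0.
Qed.

Let step_ge0 A : 0 <= one_step A.
Proof. exact: integral_ge0. Qed.

Let step_sigma_additive : semi_sigma_additive one_step.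
Proof.
move=> U mU tU mUU; rewrite [X in _ --> X](_ : _ =
    \int[mu]_x (\sum_(n <oo) k x (U n))); last first.
  apply: eq_integral => V _.
  by apply/esym/cvg_lim => //; exact/measure_semi_sigma_additive.
apply/cvg_closeP; split.
  by apply: is_cvg_nneseries => n _ _; exact: integral_ge0.
by rewrite closeE// integral_nneseries// => n; exact: measurable_kernel.
Qed.

HB.instance Definition _ := isMeasure.Build d' Y R one_step
  step0 step_ge0 step_sigma_additive.

Let step_setT : one_step setT = 1.
Proof.
rewrite /one_step (eq_integral (cst 1)); last by move=> x _; exact: prob_kernel.
by rewrite integral_cst// mul1e; exact: probability_setT.
Qed.

HB.instance Definition _ :=
  Measure_isProbability.Build d' Y R one_step step_setT.

End one_step.

Definition stationary d (X : measurableType d) (R : realType)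
    (k : R.-pker X ~> X) (mu : probability X R) :=
  forall A, measurable A -> one_step k mu A = mu A.

Local Close Scope ereal_scope.

Lemma dy_continuous (f : dyadic -> dyadic) :
  (forall k, exists n, forall a b : dyadic,
     (forall i, (i < n)%N -> a i = b i) -> f a k = f b k) ->
  continuous f.
Proof.
move=> hf a; apply/cvg_sup => k W [_ [[C oC <-] Ca CW]].
have [n hn] := hf k.
have : nbhs a [set b : dyadic | forall i : 'I_n, b i = a i].
  apply: (@filter_forall dyadic 'I_n
    (fun i => [set b : dyadic | b i = a i]) (nbhs a)) => i.
  have /(_ [set a i]) := @proj_continuous nat (fun=> bool) i a.
  by apply; exact: discrete_set1.
apply: filterS => b /= hb; apply: CW => /=.
by rewrite (hn b a)// => i ni; exact: (hb (Ordinal ni)).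
Qed.
Lemma dy_measurable (f : dyadic -> dyadic) :
  continuous f -> measurable_fun setT f.
Proof.
move=> /continuousP cf.
apply: (@measurability _ _ dyadic dyadic setT f (@open cantor_space)) => //.
move=> _ [B oB <-]; rewrite setTI; apply: sub_sigma_algebra; exact: cf.
Qed.

Lemma dy_succ_measurable : measurable_fun setT dy_succ.
Proof.
apply: dy_measurable; apply: dy_continuous => k; exists k.+1 => a b ab.
rewrite /dy_succ ab//; congr addb; apply: eq_forallb => j.
by rewrite ab// ltnS ltnW.
Qed.

Lemma dy_pred_measurable : measurable_fun setT dy_pred.
Proof.
apply: dy_measurable; apply: dy_continuous => k; exists k.+1 => a b ab.
rewrite /dy_pred ab//; congr addb; apply: eq_forallb => j.
by rewrite ab// ltnS ltnW.
Qed.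

Lemma dy_double_measurable : measurable_fun setT dy_double.
Proof.
apply: dy_measurable; apply: dy_continuous => k; exists k.+1 => a b ab.
by case: k ab => //= k ->.
Qed.

Lemma dy_half_measurable : measurable_fun setT dy_half.
Proof.
apply: dy_measurable; apply: dy_continuous => k; exists k.+2 => a b ab.
exact: ab.
Qed.

Lemma dy_odd_measurable : measurable_fun setT dy_odd.
Proof.
apply: (@measurable_fun_bool _ _ _ _ true); rewrite setTI.
apply: sub_sigma_algebra.
have h : continuous (dy_odd : cantor_space -> bool).
  by move=> a; exact: (@proj_continuous nat (fun=> bool) 0%N a).
by apply: ((continuousP _).1 h); exact: discrete_open.
Qed.

Lemma measurable_uniform_choice (R : realType) (fs : seq (dyadic -> dyadic))
    (A : set dyadic) :
  measurable A -> (forall f, List.In f fs -> measurable_fun setT f) ->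
  measurable_fun setT
    (fun a => uniform_choice [seq f a | f <- fs] A : \bar R).
Proof.
move=> mA mfs; rewrite /uniform_choice.
under eq_fun do rewrite size_map big_map.
apply: measurable_funeM.
elim: fs mfs => [|f fs IH] mfs.
  by under eq_fun do rewrite big_nil; exact: measurable_cst.
under eq_fun do rewrite big_cons; apply: emeasurable_funD.
  have mf : measurable_fun setT f by apply: mfs; left.
  exact: (measurable_kernel (kdirac (R := R) mf) A mA).
by apply: IH => g gfs; apply: mfs; right.
Qed.

Section graph_walk.
Variable R : realType.

Definition graph_walk (a : dyadic) : {measure set dyadic -> \bar R} :=
  uniform_choice (graph_neighbours a).

Let graph_walk_measurable A : measurable A ->
  measurable_fun setT (graph_walk ^~ A).
Proof.
move=> mA; rewrite [X in measurable_fun _ X](_ : _ = fun a =>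
    if dy_odd a
    then uniform_choice [seq f a | f <- [:: dy_succ; dy_pred; dy_double]] A
    else uniform_choice
      [seq f a | f <- [:: dy_succ; dy_pred; dy_double; dy_half]] A); last first.
  by apply/funext => a; rewrite /graph_walk /graph_neighbours; case: ifP.
apply: measurable_fun_ifT; first exact: dy_odd_measurable.
- by apply: measurable_uniform_choice => // f [<-|[<-|[<-|[]]]];
    [exact: dy_succ_measurable|exact: dy_pred_measurable|
     exact: dy_double_measurable].
- by apply: measurable_uniform_choice => // f [<-|[<-|[<-|[<-|[]]]]];
    [exact: dy_succ_measurable|exact: dy_pred_measurable|
     exact: dy_double_measurable|exact: dy_half_measurable].
Qed.

HB.instance Definition _ :=
  isKernel.Build _ _ _ _ R graph_walk graph_walk_measurable.

Let graph_walk_setT a : graph_walk a setT = 1%E.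
Proof. exact/uniform_choice_setT/graph_neighbours_size. Qed.

HB.instance Definition _ :=
  Kernel_isProbability.Build _ _ _ _ R graph_walk graph_walk_setT.

End graph_walk.

Section dual_walk.
Variable R : realType.

Definition dual_walk (c : dyadic) : {measure set dyadic -> \bar R} :=
  uniform_choice (dual_neighbours c).

Let dual_walk_measurable A : measurable A ->
  measurable_fun setT (dual_walk ^~ A).
Proof.
move=> mA; apply: (@measurable_uniform_choice R
  [:: dy_succ; dy_pred; dy_half; dy_double; dy_succ \o dy_double]) => // f.
move=> [<-|[<-|[<-|[<-|[<-|[]]]]]].
- exact: dy_succ_measurable.
- exact: dy_pred_measurable.
- exact: dy_half_measurable.
- exact: dy_double_measurable.
- exact: measurableT_comp dy_succ_measurable dy_double_measurable.
Qed.

HB.instance Definition _ :=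
  isKernel.Build _ _ _ _ R dual_walk dual_walk_measurable.

Let dual_walk_setT a : dual_walk a setT = 1%E.
Proof. exact/uniform_choice_setT/dual_neighbours_size. Qed.

HB.instance Definition _ :=
  Kernel_isProbability.Build _ _ _ _ R dual_walk dual_walk_setT.

End dual_walk.

Section random_face.
Variable R : realType.

Definition random_face (a : dyadic) : {measure set dyadic -> \bar R} :=
  uniform_choice (incident_faces a).

Let random_face_measurable A : measurable A ->
  measurable_fun setT (random_face ^~ A).
Proof.
move=> mA; rewrite [X in measurable_fun _ X](_ : _ = fun a =>
    if dy_odd a
    then uniform_choice [seq f a | f <- [:: id; dy_pred; dy_half \o dy_pred]] A
    else uniform_choice
      [seq f a | f <- [:: id; dy_pred; dy_half; dy_pred \o dy_half]] A);
  last first.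
  by apply/funext => a; rewrite /random_face /incident_faces; case: ifP.
apply: measurable_fun_ifT; first exact: dy_odd_measurable.
- apply: measurable_uniform_choice => // f [<-|[<-|[<-|[]]]].
  + exact: measurable_id.
  + exact: dy_pred_measurable.
  + exact: measurableT_comp dy_half_measurable dy_pred_measurable.
- apply: measurable_uniform_choice => // f [<-|[<-|[<-|[<-|[]]]]].
  + exact: measurable_id.
  + exact: dy_pred_measurable.
  + exact: dy_half_measurable.
  + exact: measurableT_comp dy_pred_measurable dy_half_measurable.
Qed.

HB.instance Definition _ :=
  isKernel.Build _ _ _ _ R random_face random_face_measurable.

Let random_face_setT a : random_face a setT = 1%E.
Proof. exact/uniform_choice_setT/incident_faces_size. Qed.

HB.instance Definition _ :=
  Kernel_isProbability.Build _ _ _ _ R random_face random_face_setT.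

End random_face.

Definition induced_dual (R : realType) (mu : probability dyadic R) :
    probability dyadic R :=
  one_step (@random_face R) mu.

(* Main.v *)
(* If nu << rho then mu << rho, because the root label of Gamma_a is itself the
   label of an incident face. The dual walk contracts 2-adic distances on
   average, so rho integrates functions of finitely many digits as Haar measure
   does. Put u_k = (-1)^(x_k + x_(k+1)) and S_n = u_0 + ... + u_(n-1). The u_k
   are orthonormal for Haar measure, so S_n / n tends to 0 in rho-probability
   and therefore in mu-probability.

   The graph walk contradicts this. Let Q_m(x) = S_m(x) + S_m(x - 1). Adding 1
   to x changes the sign of exactly one u_k, so the sum of Q_m(y) - Q_m(x) over
   the neighbours y of x is K(x) plus a second difference of Q_m in m (x even)
   or Q_(m-1)(x) - Q_m(x) (x odd), where K depends only on the digits around the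
   first run. The mean of K under mu is positive: for an explicit
   function F of finitely many digits, 1000 K(x) plus the sum of F(y) - F(x) is
   at least 1 for every x. Summed over m, the test function F + 1000 Q_m has
   drift at least n - O(1 + |S_n|), while stationarity of mu makes the mean
   drift 0. *)
From Stdlib Require Import ZArith.
From HB Require Import structures.
Require Import Defs.
From mathcomp Require Import all_boot all_order all_algebra.
From mathcomp Require Import zify ssrZ ring lra.
From mathcomp Require Import all_classical all_reals all_analysis.
From mathcomp Require Import measurable_realfun.

Set Implicit Arguments.
Unset Strict Implicit.
Unset Printing Implicit Defensive.

Import Order.TTheory GRing.Theory Num.Theory.
Import numFieldNormedType.Exports.

(** * Arithmetic of the digits *)

Lemma dy_doubleK (x : dyadic) : dy_half (dy_double x) = x.
Proof. by []. Qed.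

Lemma dy_halfK (x : dyadic) : ~~ dy_odd x -> dy_double (dy_half x) = x.
Proof. by move=> /negbTE x0; apply/funext; case. Qed.

Lemma forall_ord_recl n (P : pred nat) :
  [forall j : 'I_n.+1, P j] = P 0%N && [forall j : 'I_n, P j.+1].
Proof.
apply/forallP/andP => [h|[P0 /forallP h] [[//|j] jn]].
  by split; [exact: (h ord0)|apply/forallP => j; exact: (h (lift ord0 j))].
exact: (h (@Ordinal n j jn)).
Qed.

Lemma odd_succ x : dy_odd (dy_succ x) = ~~ dy_odd x.
Proof.
rewrite /dy_odd /dy_succ; case: forallP => [_|[]]; first by rewrite addbT.
by case.
Qed.

Lemma odd_pred x : dy_odd (dy_pred x) = ~~ dy_odd x.
Proof.
rewrite /dy_odd /dy_pred; case: forallP => [_|[]]; first by rewrite addbT.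
by case.
Qed.

Lemma half_succ x :
  dy_half (dy_succ x) = if dy_odd x then dy_succ (dy_half x) else dy_half x.
Proof.
apply/funext => k; rewrite /dy_half /dy_succ forall_ord_recl /dy_odd.
by case: (x 0%N) => /=; rewrite ?addbF.
Qed.

Lemma half_pred x :
  dy_half (dy_pred x) = if dy_odd x then dy_half x else dy_pred (dy_half x).
Proof.
apply/funext => k.
rewrite /dy_half /dy_pred (forall_ord_recl k (fun j => ~~ x j)) /dy_odd.
by case: (x 0%N) => /=; rewrite ?addbF.
Qed.

Lemma dy_ext (x y : dyadic) :
  dy_odd x = dy_odd y -> dy_half x = dy_half y -> x = y.
Proof. by move=> h0 h; apply/funext => -[//|k]; exact: (congr1 (@^~ k) h). Qed.

Lemma pred_succ x : dy_pred (dy_succ x) = x.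
Proof.
apply/funext => k; elim: k x => [|k IH] x.
  by have := odd_pred (dy_succ x); rewrite odd_succ negbK.
rewrite -[LHS]/(dy_half _ k) half_pred odd_succ half_succ.
by case: (dy_odd x) => //=; rewrite IH.
Qed.

Local Open Scope Z_scope.

#[local] Arguments Z.add : simpl never.
#[local] Arguments Z.sub : simpl never.
#[local] Arguments Z.mul : simpl never.

(** The sign $u_0$; [sign_sum n] is $S_n$. Both are invariant under complementing all digits. *)
Definition parity_sign (x : dyadic) : Z :=
  if dy_odd x == dy_odd (dy_half x) then 1 else -1.

Fixpoint sign_sum n (x : dyadic) : Z :=
  if n is n'.+1 then parity_sign x + sign_sum n' (dy_half x) else 0.

(* The sign u_t at the place t where the carry of x + 1 stops; 0 if t >= n. *)
Fixpoint carry_sign n (x : dyadic) : Z :=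
  if n is n'.+1 then
    if dy_odd x then carry_sign n' (dy_half x) else parity_sign x
  else 0.

(* Likewise for the borrow of x - 1. *)
Fixpoint borrow_sign n (x : dyadic) : Z :=
  if n is n'.+1 then
    if dy_odd x then parity_sign x else borrow_sign n' (dy_half x)
  else 0.

(** If the carry stops at place t, adding 1 flips exactly the digits 0 to t. Below t both digits
    compared by $u_k$ flip, above t neither does, and $u_t$ alone compares a flipped digit with an
    unflipped one. *)
Lemma sign_sum_succ n x :
  sign_sum n (dy_succ x) = sign_sum n x - 2 * carry_sign n x.
Proof.
elim: n x => [//|n IH] x /=; rewrite half_succ /parity_sign odd_succ half_succ.
case: (dy_odd x); last by case: (dy_odd _) => /=; lia.
by rewrite odd_succ IH; case: (dy_odd _) => /=; lia.
Qed.

Lemma sign_sum_pred n x :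
  sign_sum n (dy_pred x) = sign_sum n x - 2 * borrow_sign n x.
Proof.
elim: n x => [//|n IH] x /=; rewrite half_pred /parity_sign odd_pred half_pred.
case: (dy_odd x); first by case: (dy_odd _) => /=; lia.
by rewrite odd_pred IH; case: (dy_odd _) => /=; lia.
Qed.

Lemma parity_sign_bound x : -1 <= parity_sign x <= 1.
Proof. by rewrite /parity_sign; case: ifP. Qed.

Lemma carry_sign_bound n x : -1 <= carry_sign n x <= 1.
Proof.
by elim: n x => [//|n IH] x /=; case: ifP => // _; exact: parity_sign_bound.
Qed.

Lemma borrow_sign_bound n x : -1 <= borrow_sign n x <= 1.
Proof.
by elim: n x => [//|n IH] x /=; case: ifP => // _; exact: parity_sign_bound.
Qed.

Lemma sign_sum_bound n x : - Z.of_nat n <= sign_sum n x <= Z.of_nat n.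
Proof.
elim: n x => [//|n IH] x; have := IH (dy_half x).
by have := parity_sign_bound x; rewrite /=; lia.
Qed.

Lemma sign_sumS n x : -1 <= sign_sum n.+1 x - sign_sum n x <= 1.
Proof.
elim: n x => [|n IH] x; first by have := parity_sign_bound x; rewrite /=; lia.
by have := IH (dy_half x); rewrite /=; lia.
Qed.

(** This is $Q_n$. Since $-x$ is the complement of $x - 1$, it equals $S_n(x) + S_n(-x)$, the
    symmetrization of $S_n$ under negation. *)
Definition sym_sum n (x : dyadic) : Z := sign_sum n x + sign_sum n (dy_pred x).

Lemma sym_sumE n x : sym_sum n x = 2 * (sign_sum n x - borrow_sign n x).
Proof. by rewrite /sym_sum sign_sum_pred; lia. Qed.

(** Dropping the units digit of 2x and 2x - 1 leaves x and x - 1. The two lowest signs agree: both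
    are 1 for x even and -1 for x odd. *)
Lemma sym_sum_double n x :
  sym_sum n.+1 (dy_double x) = sym_sum n x + (if dy_odd x then -2 else 2).
Proof.
rewrite /sym_sum /= /parity_sign half_pred odd_pred !dy_doubleK /= odd_pred.
by case: (dy_odd x) => /=; lia.
Qed.

Lemma sym_sum_half n x : ~~ dy_odd x ->
  sym_sum n (dy_half x) = sym_sum n.+1 x - 2 * parity_sign x.
Proof.
move=> /negbTE x0; rewrite /sym_sum /= /parity_sign half_pred odd_pred x0 /=.
by rewrite odd_pred; case: (dy_odd (dy_half x)) => /=; lia.
Qed.

(** The carry of x and the borrow of x - 1 stop at digit 0, and $u_0(x - 1) = u_0(x)$. With
    [sym_sum_double] and [sym_sum_half] this gives $K = 2 - 6 u_0$ at even x. *)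
Lemma sym_sum_even n x : ~~ dy_odd x ->
  sym_sum n.+1 (dy_succ x) + sym_sum n.+1 (dy_pred x) =
  2 * sym_sum n.+1 x - 4 * parity_sign x.
Proof.
move=> /negbTE x0; rewrite {1}/sym_sum pred_succ sym_sumE /sym_sum.
rewrite sign_sum_succ /= odd_pred x0 /= /parity_sign odd_pred half_pred x0.
by rewrite odd_pred /=; case: (dy_odd (dy_half x)) => /=; lia.
Qed.

(** The carry of x and the borrow of x - 1 pass digit 0 and continue in [dy_half x], with one place
    fewer. With [sym_sum_double] this gives $K = -2 - 2(c + b)$ for the two signs c and b found
    there. *)
Lemma sym_sum_odd n x : dy_odd x ->
  sym_sum n.+1 (dy_succ x) + sym_sum n.+1 (dy_pred x) =
  2 * sym_sum n.+1 x
    - 2 * (carry_sign n (dy_half x) + borrow_sign n (dy_half x)).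
Proof.
move=> x0; rewrite {1}/sym_sum pred_succ sym_sumE /sym_sum.
by rewrite sign_sum_succ /= odd_pred x0 /= half_pred x0; lia.
Qed.

(** * A potential with positive drift *)

(* Tries are read from the units digit upwards. *)
Inductive trie := Leaf of Z | Node of trie & trie.

Fixpoint teval t (x : dyadic) : Z :=
  match t with
  | Leaf z => z
  | Node l r => if dy_odd x then teval r (dy_half x) else teval l (dy_half x)
  end.

Fixpoint tmap (f : Z -> Z) t :=
  match t with
  | Leaf z => Leaf (f z)
  | Node l r => Node (tmap f l) (tmap f r)
  end.

Fixpoint tadd s t :=
  match s, t with
  | Leaf a, _ => tmap (Z.add a) t
  | _, Leaf b => tmap (Z.add b) s
  | Node l r, Node l' r' => Node (tadd l l') (tadd r r')
  end.

Fixpoint tsucc t :=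
  match t with
  | Leaf z => Leaf z
  | Node l r => Node r (tsucc l)
  end.

Fixpoint tpred t :=
  match t with
  | Leaf z => Leaf z
  | Node l r => Node (tpred r) l
  end.

Definition teven t := if t is Node l _ then l else t.

Definition todd t := if t is Node _ r then r else t.

Fixpoint tcompl t :=
  match t with
  | Leaf z => Leaf z
  | Node l r => Node (tcompl r) (tcompl l)
  end.

Fixpoint tall (p : Z -> bool) t :=
  match t with
  | Leaf z => p z
  | Node l r => tall p l && tall p r
  end.

Lemma teval_map f t x : teval (tmap f t) x = f (teval t x).
Proof. by elim: t x => //= l IHl r IHr x; case: ifP. Qed.

Lemma teval_add s t x : teval (tadd s t) x = teval s x + teval t x.
Proof.
elim: s t x => [a|l IHl r IHr] t x; first by rewrite /= teval_map.
case: t => [b|l' r'] /=; last by case: ifP.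
by rewrite !teval_map; case: ifP => _; lia.
Qed.

Lemma teval_succ t x : teval (tsucc t) x = teval t (dy_succ x).
Proof.
elim: t x => //= l IHl r IHr x; rewrite odd_succ half_succ.
by case: (dy_odd x).
Qed.

Lemma teval_pred t x : teval (tpred t) x = teval t (dy_pred x).
Proof.
elim: t x => //= l IHl r IHr x; rewrite odd_pred half_pred.
by case: (dy_odd x).
Qed.

Lemma teval_even t x : teval (teven t) x = teval t (dy_double x).
Proof. by case: t. Qed.

Lemma teval_odd t x : dy_odd x -> teval (todd t) (dy_half x) = teval t x.
Proof. by case: t => //= l r ->. Qed.

(** Reduces an inequality over all dyadic integers to a computation on finitely many leaves. *)
Lemma teval_all (p : Z -> bool) t x : tall p t -> p (teval t x).
Proof.
by elim: t x => //= l IHl r IHr x /andP[pl pr]; case: ifP => _;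
  [exact: IHr|exact: IHl].
Qed.

Fixpoint carry_trie n :=
  if n is n'.+1 then Node (Node (Leaf 1) (Leaf (-1))) (carry_trie n')
  else Leaf 1.

Fixpoint borrow_trie n :=
  if n is n'.+1 then Node (borrow_trie n') (Node (Leaf (-1)) (Leaf 1))
  else Leaf 1.

(** The trie holds the exact sign when the carry stops among the first m digits; otherwise its last
    leaf 1 is the trivial bound. So one trie serves every n >= m. *)
Lemma carry_trieP m n x :
  (m <= n)%N -> carry_sign n x <= teval (carry_trie m) x.
Proof.
elim: m n x => [|m IH] n x; first by move=> _; exact: (carry_sign_bound n x).2.
case: n => //= n mn.
case: ifP => x0; first exact: IH.
by rewrite /parity_sign x0; case: (dy_odd _).
Qed.

Lemma borrow_trieP m n x :
  (m <= n)%N -> borrow_sign n x <= teval (borrow_trie m) x.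
Proof.
elim: m n x => [|m IH] n x; first by move=> _; exact: (borrow_sign_bound n x).2.
case: n => //= n mn.
case: ifP => x0; last exact: IH.
by rewrite /parity_sign x0; case: (dy_odd _).
Qed.

Section certificate.
Local Coercion Leaf : Z >-> trie.
Local Notation "l # r" := (Node l r) (at level 50, no associativity).

(* Found by value iteration for the drift inequalities [even_drift_gt0] and
   [odd_drift_gt0]. The entry of index j gives the potential of the numbers
   2 ^ (j + 1) * (1 + 4 w), as a function of w; the potential of even numbers is
   chosen invariant under negation, which complements the digits above the
   lowest nonzero one. *)
Definition even_table : seq trie :=
  [:: (((((((((6003 # 6375) # (7948 # 6818)) # (8724 # 7170)) # (9148 # 7411)) #
    ((9394 # 9408) # (7590 # 7575))) # (((9563 # 9585) # (9625 # 9606)) # ((7755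
    # 7775) # (7735 # 7712)))) # (((((9726 # 9760) # 9765) # (9830 # 9793)) #
    (9886 # (9848 # 9831))) # (((7959 # 7975) # 8016) # ((7923 # 7962) # (7894 #
    (7889 # 7854)))))) # ((((((9957 # 10017) # (10122 # 10055)) # (10139 #
    10067)) # (10215 # 10107)) # (((10318 # 10336) # 10353) # ((10238 # 10264) #
    (10214 # 10187)))) # ((((8291 # 8318) # (8365 # 8341)) # (8471 # (8455 #
    8436))) # ((8222 # 8342) # ((8181 # 8265) # ((8167 # 8243) # ((8125 # 8194)
    # 8058))))))) # ((((((((10414 # 10504) # (10647 # 10523)) # (10724 # 10586))
    # (10821 # 10629)) # (10856 # 10656)) # (((10956 # 10975) # 10988) # (10758
    # (10743 # 10720)))) # (((((11177 # 11201) # 11206) # (11260 # 11232)) #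
    (11317 # (11298 # 11281))) # ((11020 # 11099) # ((10982 # 11031) # ((10958 #
    11005) # (10942 # 10898)))))) # ((((((8940 # 8981) # (9030 # 8989)) # (9064
    # 9018)) # (9125 # 9052)) # (((9380 # 9397) # 9418) # ((9336 # 9365) # (9310
    # (9306 # 9279))))) # ((((8807 # 8830) # 8845) # (9139 # (9126 # 9106))) #
    ((8745 # 9017) # ((8713 # 8962) # ((8659 # 8894) # ((8587 # 8745) # (8554 #
    8442))))))))) # (((((((((11497 # 11643) # (11971 # 11749)) # (12133 #
    11794)) # (12221 # 11863)) # (12315 # 11913)) # (((12383 # 12403) # 12415) #
    (12002 # (11991 # 11969)))) # (((((12540 # 12567) # 12571) # (12628 #
    12597)) # (12675 # (12653 # 12637))) # ((12186 # 12243) # ((12156 # 12197) #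
    (12128 # (12121 # 12084)))))) # ((((((13071 # 13118) # (13192 # 13141)) #
    (13211 # 13158)) # (13281 # 13196)) # (((13420 # 13436) # 13454) # ((13365 #
    13391) # (13340 # 13313)))) # ((((12789 # 12812) # 12823) # (13013 # (12999
    # 12981))) # ((12725 # 12882) # ((12691 # 12843) # ((12664 # 12766) #
    ((12610 # 12707) # (12594 # 12523)))))))) # (((((((10331 # (10486 # 10404))
    # (10538 # 10452)) # (10588 # 10470)) # (10642 # 10508)) # (((10733 # 10751)
    # 10766) # ((10611 # 10632) # (10595 # 10571)))) # ((((11357 # 11384) #
    (11433 # 11408)) # (11505 # (11488 # 11471))) # ((11264 # 11357) # ((11225 #
    11284) # ((11214 # 11271) # (11181 # 11129)))))) # ((((((10096 # 10131) #
    10136) # (10204 # 10165)) # (10250 # (10211 # 10196))) # (((10928 # 10945) #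
    10969) # ((10892 # 10924) # (10864 # (10861 # 10831))))) # ((((9988 # 10010)
    # 10022) # (10732 # (10719 # 10698))) # ((9919 # 10599) # ((9839 # 10497) #
    ((9757 # 10328) # ((9648 # 10025) # (9466 # 9256)))))))));
((((((((5695 # 5998) # (6881 # 6264)) # (7346 # 6454)) # (7590 # 6571)) # ((7739
    # 7754) # (6689 # 6675))) # (((7864 # 7888) # (7925 # 7907)) # ((6814 #
    6833) # (6796 # 6771)))) # (((((8004 # 8040) # 8044) # (8112 # 8073)) #
    (8166 # (8131 # 8112))) # (((6999 # 7017) # 7059) # ((6964 # 7008) # (6934 #
    (6929 # 6889)))))) # ((((((8270 # 8333) # (8440 # 8370)) # (8455 # 8382)) #
    (8532 # (8435 # 8423))) # (((8646 # 8666) # 8688) # ((8571 # 8599) # (8545 #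
    (8533 # 8515))))) # ((((7359 # 7387) # (7434 # 7408)) # (7563 # (7543 #
    7522))) # (((7289 # 7301) # 7427) # ((7249 # 7361) # ((7232 # 7322) # ((7186
    # 7271) # 7107))))))) # ((((((((8984 # 9075) # (9216 # 9092)) # (9284 #
    9153)) # (9376 # 9190)) # (9412 # 9220)) # (((9515 # 9536) # 9555) # ((9329
    # 9346) # (9314 # 9287)))) # (((((9798 # 9821) # 9830) # (9887 # 9856)) #
    (9955 # (9931 # 9912))) # ((9654 # 9742) # ((9614 # 9672) # ((9591 # 9646) #
    (9573 # 9521)))))) # ((((((8235 # 8280) # (8331 # 8292)) # (8366 # 8317)) #
    (8421 # (8362 # 8350))) # (((8758 # 8777) # 8804) # ((8713 # 8747) # (8686 #
    (8681 # 8651))))) # ((((8106 # 8131) # (8163 # 8147)) # (8517 # (8500 #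
    8478))) # ((8043 # 8398) # ((8002 # 8320) # ((7940 # 8245) # ((7887 # 8096)
    # (7812 # 7668))))))));
(((((((4982 # 5188) # (5659 # 5332)) # (5876 # 5400)) # (6002 # 5477)) # ((6099
    # 6112) # (5556 # 5543))) # (((6181 # 6206) # (6240 # 6224)) # ((5651 #
    5669) # (5634 # 5607)))) # (((((6340 # 6375) # 6380) # (6448 # 6409)) #
    ((6505 # 6517) # (6472 # 6452))) # (((5846 # 5862) # (5924 # 5912)) # ((5811
    # 5860) # ((5784 # 5818) # (5773 # 5728)))))) # ((((((6740 # 6801) # (6899 #
    6833)) # (6916 # 6847)) # ((6992 # 7003) # (6901 # 6889))) # (((7133 # 7154)
    # (7191 # 7178)) # ((7065 # 7097) # (7039 # (7027 # 7006))))) # (((((6330 #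
    6347) # 6360) # (6400 # 6376)) # ((6575 # 6589) # (6555 # 6533))) # (((6259
    # 6272) # (6439 # 6427)) # ((6220 # 6379) # ((6196 # 6310) # ((6143 # 6252)
    # (6118 # 6045)))))));
((((((4379 # 4504) # (4715 # 4544)) # (4827 # 4603)) # (4906 # 4654)) # ((4953 #
    4965) # (4699 # 4686))) # (((5056 # 5081) # (5116 # 5100)) # ((4803 # 4823)
    # (4785 # (4773 # 4756))))) # (((((5270 # 5303) # 5308) # (5373 # 5337)) #
    ((5442 # 5455) # (5413 # 5392))) # (((5060 # 5074) # (5164 # 5151)) # ((5019
    # 5079) # ((4992 # 5049) # (4977 # 4923)))));
(((((3995 # 4045) # (4149 # 4075)) # (4208 # 4118)) # (4240 # 4135)) # ((4312 #
    4326) # (4192 # 4178))) # (((4428 # 4452) # (4491 # 4476)) # ((4325 # 4357)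
    # (4297 # (4284 # 4263))));
(((3744 # 3788) # (3830 # 3799)) # (3873 # 3826)) # ((3943 # 3957) # (3892 #
    3871));
((3537 # 3554) # 3566) # (3618 # 3593);
3304 # 3324;
Leaf 2971;
Leaf 2454;
Leaf 1658;
Leaf 572].

End certificate.

(** Left branches strip factors of 2, and [tcompl] extends each entry from $2^{j+1}(1 + 4w)$ to its
    negative, where w becomes its complement. Numbers divisible by a power of 2 beyond the table get
    the value 0. *)
Fixpoint mirror s :=
  if s is t :: s' then Node (mirror s') (Node t (tcompl t)) else Leaf 0.

Definition run_trie := tadd (carry_trie 13) (borrow_trie 13).

(* At odd numbers the drift inequality, which bounds the potential from above
   by its values at even numbers, is made an equality up to rounding. *)
Definition potential_trie : trie :=
  let e := Node (mirror even_table) (Leaf 0) in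
  let s := tadd (tadd (tsucc e) (tpred e)) (teven e) in
  Node (mirror even_table)
    (tmap (fun z => (z - 2001) / 3)
      (tadd (todd s) (tmap (Z.mul (-2000)) run_trie))).

(** [Node t t] ignores the units digit, so it evaluates [t] at x / 2. *)
Definition even_drift t : trie :=
  tadd (tadd (tsucc t) (tpred t))
    (tadd (tadd (teven t) (Node t t)) (tmap (Z.mul (-4)) t)).

Definition odd_drift t : trie :=
  tadd (tadd (tsucc t) (tpred t)) (tadd (teven t) (tmap (Z.mul (-3)) t)).

Definition parity_trie : trie :=
  Node (Node (Leaf 1) (Leaf (-1))) (Node (Leaf (-1)) (Leaf 1)).

Definition potential (x : dyadic) : Z := teval potential_trie x.

(** The numerical certificate: the added trie is $1000 K$ at even numbers. *)
Lemma even_drift_gt0 : tall (Z.ltb 0)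
  (teven (tadd (even_drift potential_trie)
            (tmap (fun z => 2000 - 6000 * z) parity_trie))).
Proof. by vm_compute. Qed.

(** Built into [potential_trie]: all neighbours of an odd number are even, so its value is solved
    for from the even ones. Subtracting 2001 rather than 2000 there makes the inequality strict
    after rounding down. *)
Lemma odd_drift_gt0 : tall (Z.ltb 0)
  (tadd (todd (odd_drift potential_trie))
     (tmap (fun z => - 2000 - 2000 * z) run_trie)).
Proof. by vm_compute. Qed.

Lemma potential_even x : ~~ dy_odd x ->
  4 * potential x + 6000 * parity_sign x - 2000 <
  potential (dy_succ x) + potential (dy_pred x)
    + potential (dy_double x) + potential (dy_half x).
Proof.
move=> x0; have := teval_all (dy_half x) even_drift_gt0.
rewrite teval_even dy_halfK// /even_drift 5!teval_add 2!teval_map teval_succ.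
rewrite teval_pred teval_even.
have -> : teval (Node potential_trie potential_trie) x = potential (dy_half x).
  by rewrite /=; case: ifP.
have -> : teval parity_trie x = parity_sign x.
  by rewrite /= /parity_sign; do 2 case: dy_odd.
by rewrite -!/(potential _); move/Z.ltb_lt; lia.
Qed.

Lemma potential_odd n x : (13 <= n)%N -> dy_odd x ->
  3 * potential x + 2000 +
    2000 * (carry_sign n (dy_half x) + borrow_sign n (dy_half x)) <
  potential (dy_succ x) + potential (dy_pred x) + potential (dy_double x).
Proof.
move=> n13 x0; have := teval_all (dy_half x) odd_drift_gt0.
rewrite teval_add teval_odd// /odd_drift 3!teval_add 2!teval_map teval_succ.
rewrite teval_pred teval_even /run_trie teval_add.
have := @carry_trieP _ _ (dy_half x) n13.
have := @borrow_trieP _ _ (dy_half x) n13.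
by rewrite -!/(potential _) => h1 h2 /Z.ltb_lt; lia.
Qed.

(** The index m of $Q_m$ runs from 14 to 13 + n: at odd x, [sym_sum_odd] yields signs truncated at m
    - 1 places, and [run_trie] bounds them once m - 1 >= 13. *)
Fixpoint test_sum n (x : dyadic) : Z :=
  if n is n'.+1 then
    test_sum n' x + potential x + 1000 * sym_sum (14 + n') x
  else 0.

Lemma test_sumS n x :
  test_sum n.+1 x = test_sum n x + potential x + 1000 * sym_sum (13 + n)%N.+1 x.
Proof. by []. Qed.

Definition neighbour_sum (f : dyadic -> Z) (x : dyadic) : Z :=
  f (dy_succ x) + f (dy_pred x) + f (dy_double x)
    + (if dy_odd x then 0 else f (dy_half x)).

Definition degree (x : dyadic) : Z := if dy_odd x then 3 else 4.

Lemma sym_sumS n x : -2 <= sym_sum n.+1 x - sym_sum n x <= 2.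
Proof.
have := sign_sumS n x; have := sign_sumS n (dy_pred x).
by rewrite /sym_sum; lia.
Qed.

Lemma sym_sum_bound n x : Z.abs (sym_sum n x) <= 2 * Z.abs (sign_sum n x) + 2.
Proof. by rewrite sym_sumE; have := borrow_sign_bound n x; lia. Qed.

(** Each summand gains at least 1 by [potential_odd], and the differences $Q_{m-1} - Q_m$
    telescope. *)
Lemma test_sum_odd n x : dy_odd x ->
  degree x * test_sum n x + Z.of_nat n
    + 1000 * (sym_sum 13 x - sym_sum (13 + n)%N x)
  <= neighbour_sum (test_sum n) x.
Proof.
move=> x0; rewrite /degree /neighbour_sum x0.
elim: n => [|n]; first by rewrite addn0 /test_sum; lia.
have := potential_odd (leq_addr n 13) x0.
have := sym_sum_odd (13 + n)%N x0.
have := sym_sum_double (13 + n)%N x; rewrite x0.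
rewrite addnS !test_sumS; lia.
Qed.

(** Here second differences $Q_{m-1} - 2 Q_m + Q_{m+1}$ telescope to two first differences. *)
Lemma test_sum_even n x : ~~ dy_odd x ->
  degree x * test_sum n x + Z.of_nat n
    + 1000 * (sym_sum 13 x - sym_sum 14 x
              - (sym_sum (13 + n) x - sym_sum (13 + n)%N.+1 x))
  <= neighbour_sum (test_sum n) x.
Proof.
move=> x0; rewrite /degree /neighbour_sum (negbTE x0).
elim: n => [|n]; first by rewrite !addn0 /test_sum; lia.
have := potential_even x0.
have := sym_sum_even (13 + n)%N x0.
have := sym_sum_double (13 + n)%N x; rewrite (negbTE x0).
have := sym_sum_half (13 + n)%N.+1 x0.
rewrite !addnS !test_sumS; lia.
Qed.

(** At odd x, 30000 collects $1000 |Q_{13}| \le 28000$ and the 2000 left over from $|Q_{13+n}| \le 2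
    |S_{13+n}| + 2$. At even x only first differences of size at most 2 remain. *)
Lemma test_sum_drift n x :
  degree x * test_sum n x + Z.of_nat n
    - (30000 + 2000 * Z.abs (sign_sum (13 + n)%N x))
  <= neighbour_sum (test_sum n) x.
Proof.
have hs := @sym_sum_bound (13 + n)%N x.
have h13 := @sym_sum_bound 13 x; have b13 := @sign_sum_bound 13 x.
case/boolP: (dy_odd x) => x0.
  by have := @test_sum_odd n x x0; lia.
have := @test_sum_even n x x0; have := @sym_sumS 13 x.
by have := @sym_sumS (13 + n)%N x; lia.
Qed.

Local Close Scope Z_scope.
Local Open Scope classical_set_scope.
Local Open Scope ring_scope.

(** * Haar expectation and the dual walk *)

Section kernel_integrals.
Local Open Scope ereal_scope.

Lemma integral_probability_cst d (T : measurableType d) (R : realType)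
    (P : probability T R) (c : R) : \int[P]_x c%:E = c%:E.
Proof.
rewrite integral_cst// [X in _ * X](_ : _ = 1) ?mule1//.
exact: probability_setT.
Qed.

Lemma integral_one_step d d' (X : measurableType d) (Y : measurableType d')
    (R : realType) (k : R.-pker X ~> Y) (mu : probability X R)
    (f : Y -> \bar R) :
  (forall y, 0 <= f y) -> measurable_fun setT f ->
  \int[one_step k mu]_y f y = \int[mu]_x \int[k x]_y f y.
Proof.
move=> f0 mf.
(* [mu] becomes a constant kernel on [unit], so that the integral formula for composed kernels
   applies. *)
have mmu : measurable_fun setT (fun _ : unit => mu : pprobability X R).
  exact: measurable_cst.
rewrite -(@integral_kcomp _ _ _ _ _ _ _ (kprobability mmu)
  (kernel.kernel_snd k) tt f f0 mf).
by apply: eq_measure_integral.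
Qed.

Lemma integral_stationary d (X : measurableType d) (R : realType)
    (k : R.-pker X ~> X) (mu : probability X R) (f : X -> \bar R) :
  stationary k mu -> (forall y, 0 <= f y) -> measurable_fun setT f ->
  \int[mu]_y f y = \int[mu]_x \int[k x]_y f y.
Proof.
move=> kmu f0 mf; rewrite -integral_one_step//.
by apply: eq_measure_integral => A mA _; exact/esym/kmu.
Qed.

Lemma integral_uniform_choice d (T : measurableType d) (R : realType)
    (s : seq T) (f : T -> \bar R) :
  (forall y, 0 <= f y) -> measurable_fun setT f ->
  \int[uniform_choice s]_y f y = (size s)%:R^-1%:E * \sum_(x <- s) f x.
Proof.
move=> f0 mf.
have [->|[x0 _]] : s = [::] \/ exists x0 : T, True.
    by case: s => [|x ?]; [left|right; exists x].
  rewrite big_nil mule0 -[RHS](integral_measure_zero setT f).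
  apply: eq_measure_integral => A mA _.
  by rewrite /= /uniform_choice big_nil mule0.
have s0 : (0 <= (size s)%:R^-1 :> R)%R by rewrite invr_ge0.
pose m := mscale (NngNum s0) (msum (fun i => \d_(nth x0 s i)) (size s)).
transitivity (\int[m]_y f y).
  apply: eq_measure_integral => A mA _.
  by rewrite /m /= /mscale /= /msum /uniform_choice (big_nth x0) big_mkord.
rewrite ge0_integral_mscale//= ge0_integral_measure_sum//.
rewrite (big_nth x0) big_mkord; congr (_ * _); apply: eq_bigr => i _.
by rewrite integral_dirac// diracT mul1e.
Qed.

End kernel_integrals.

(** * Functions of finitely many digits *)

Definition agree n (a b : dyadic) := forall i, (i < n)%N -> a i = b i.

Definition cylindrical T n (f : dyadic -> T) :=
  forall a b, agree n a b -> f a = f b.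

Lemma agree_le m n a b : (m <= n)%N -> agree n a b -> agree m a b.
Proof. by move=> mn ab i im; apply: ab; exact: leq_trans im mn. Qed.

Lemma agree_half n a b : agree n a b -> agree n.-1 (dy_half a) (dy_half b).
Proof. by case: n => [//|n] ab i im; exact: (ab i.+1). Qed.

Lemma agree_double n a b :
  agree n a b -> agree n.+1 (dy_double a) (dy_double b).
Proof. by move=> ab [//|i] im; exact: ab. Qed.

Lemma agree_succ n a b : agree n a b -> agree n (dy_succ a) (dy_succ b).
Proof.
move=> ab i im; rewrite /dy_succ ab//; congr addb; apply: eq_forallb => j.
by rewrite ab// (ltn_trans _ im).
Qed.

Lemma agree_pred n a b : agree n a b -> agree n (dy_pred a) (dy_pred b).
Proof.
move=> ab i im; rewrite /dy_pred ab//; congr addb; apply: eq_forallb => j.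
by rewrite ab// (ltn_trans _ im).
Qed.

Lemma cylindrical_le T m n (f : dyadic -> T) :
  (m <= n)%N -> cylindrical m f -> cylindrical n f.
Proof. by move=> mn fm a b /(agree_le mn)/fm. Qed.

Lemma cylindrical_double T n (f : dyadic -> T) :
  cylindrical n.+1 f -> cylindrical n (f \o dy_double).
Proof. by move=> fn a b /agree_double/fn. Qed.

Lemma cylindrical_pred T n (f : dyadic -> T) :
  cylindrical n f -> cylindrical n (f \o dy_pred).
Proof. by move=> fn a b /agree_pred/fn. Qed.

Definition dy_doubleS (a : dyadic) : dyadic := dy_succ (dy_double a).

Lemma dy_oddK (x : dyadic) :
  x = if dy_odd x then dy_doubleS (dy_half x) else dy_double (dy_half x).
Proof.
apply: dy_ext; first by case: ifP => // _; rewrite odd_succ.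
by case: ifP => // _; rewrite half_succ.
Qed.

Lemma succ_doubleS a : dy_succ (dy_doubleS a) = dy_double (dy_succ a).
Proof.
by apply: dy_ext; rewrite ?half_succ !odd_succ//= half_succ.
Qed.

Lemma dy_doubleSK a : dy_half (dy_doubleS a) = a.
Proof. by rewrite half_succ. Qed.

Lemma agree_doubleS n a b :
  agree n a b -> agree n.+1 (dy_doubleS a) (dy_doubleS b).
Proof. by move=> ab; apply: agree_succ; exact: agree_double. Qed.

Lemma cylindrical_doubleS T n (f : dyadic -> T) :
  cylindrical n.+1 f -> cylindrical n (f \o dy_doubleS).
Proof. by move=> fn a b /agree_doubleS/fn. Qed.

Lemma measurable_cylindrical (R : realType) n (f : dyadic -> R) :
  cylindrical n f -> measurable_fun setT f.
Proof.
elim: n f => [|n IH] f fn.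
  have -> : f = cst (f point) by apply/funext => x; exact: fn.
  exact: measurable_cst.
have mh (g : dyadic -> R) : cylindrical n g ->
    measurable_fun setT (fun x => g (dy_half x)).
  by move=> gn; apply: measurableT_comp (IH g gn) dy_half_measurable.
rewrite [X in measurable_fun _ X](_ : _ = fun x => if dy_odd x
    then (f \o dy_doubleS) (dy_half x) else (f \o dy_double) (dy_half x)).
  apply: measurable_fun_ifT; first exact: dy_odd_measurable.
  - by apply: (mh (f \o dy_doubleS)); exact: cylindrical_doubleS.
  - by apply: (mh (f \o dy_double)); exact: cylindrical_double.
by apply/funext => x; rewrite {1}(dy_oddK x) /=; case: ifP.
Qed.

Section fair_coin.
Variable R : realType.
Implicit Types f g : dyadic -> R.

(* Haar expectation of a function of the first [n] digits *)
Fixpoint coin n f : R :=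
  if n is n'.+1 then
    (coin n' (f \o dy_double) + coin n' (f \o dy_doubleS)) / 2
  else f point.

Lemma coinD n f g : coin n (fun x => f x + g x) = coin n f + coin n g.
Proof.
elim: n f g => [//|n IH] f g /=.
by rewrite (IH (f \o _) (g \o _)) (IH (f \o _) (g \o _)); field.
Qed.

Lemma coinZ n c f : coin n (fun x => c * f x) = c * coin n f.
Proof.
elim: n f => [//|n IH] f /=.
by rewrite (IH (f \o _)) (IH (f \o _)); field.
Qed.

Lemma coin_cst n (c : R) : coin n (fun=> c) = c.
Proof. by elim: n => [//|n IH] /=; rewrite IH; field. Qed.

Lemma coin_le n f g : (forall x, f x <= g x) -> coin n f <= coin n g.
Proof.
elim: n f g => [|n IH] f g fg /=; first exact: fg.
by rewrite ler_wpM2r// lerD//; apply: IH => x; exact: fg.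
Qed.

Lemma coinS n f : cylindrical n f -> coin n.+1 f = coin n f.
Proof.
elim: n f => [|n IH] f fn.
  rewrite /= (fn (dy_double point) point)// (fn (dy_doubleS point) point)//.
  by field.
rewrite -[LHS]/((coin n.+1 (f \o dy_double) + coin n.+1 (f \o dy_doubleS)) / 2).
have /IH -> := cylindrical_double fn.
by have /IH -> := cylindrical_doubleS fn.
Qed.

(** Adding 1 exchanges the parity classes: 2a goes to 2a + 1, and 2a + 1 to 2(a + 1), where
    induction applies to a. *)
Lemma coin_succ n f : cylindrical n f -> coin n (f \o dy_succ) = coin n f.
Proof.
elim: n f => [|n IH] f fn; first exact: fn.
rewrite /= addrC; congr (_ / 2); congr (_ + _).
rewrite -[RHS]IH; last exact: cylindrical_double.
by congr coin; apply/funext => x; rewrite /= succ_doubleS.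
Qed.

Lemma coin_pred n f : cylindrical n f -> coin n (f \o dy_pred) = coin n f.
Proof.
move=> fn; rewrite -coin_succ; last exact: cylindrical_pred.
by congr coin; apply/funext => x; rewrite /= pred_succ.
Qed.

Definition dual_mean f x : R :=
  5^-1 * (f (dy_succ x) + f (dy_pred x) + f (dy_half x) + f (dy_double x)
          + f (dy_doubleS x)).

(** Haar measure is stationary for the dual walk: translations and halving preserve it, and 2c and
    2c + 1 together contribute twice the mean. *)
Lemma coin_dual_mean n f : cylindrical n f ->
  coin n.+1 (dual_mean f) = coin n f.
Proof.
move=> fn; rewrite coinZ !coinD.
have fS := cylindrical_le (leqnSn n) fn.
rewrite (coin_succ fS) (coin_pred fS) (@coinS n f)//.
rewrite -[X in _ + X]/(coin n.+1 (f \o dy_doubleS)).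
rewrite -[X in _ + X + _]/(coin n.+1 (f \o dy_double)).
rewrite (@coinS n (f \o dy_double)); last first.
  exact: cylindrical_double.
rewrite (@coinS n (f \o dy_doubleS)); last first.
  exact: cylindrical_doubleS.
have -> : coin n.+1 (fun x => f (dy_half x)) = coin n f.
  rewrite [LHS]/= (_ : (_ \o dy_doubleS) = f).
    by rewrite -[X in (X + _) / 2]/(coin n f); field.
  by apply/funext => x; rewrite /= dy_doubleSK.
have : coin n (f \o dy_double) + coin n (f \o dy_doubleS) = 2 * coin n f.
  by rewrite -(coinS fn) /=; field.
by move=> h; rewrite -!addrA h; field.
Qed.

Lemma cylindrical_dual_mean n f :
  cylindrical n f -> cylindrical n.+1 (dual_mean f).
Proof.
move=> fn a b ab; rewrite /dual_mean.
have ab' := agree_le (leqnSn n) ab.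
have ab2 := agree_le (leqnSn n) (agree_le (leqnSn n.+1) (agree_double ab)).
have ab3 := agree_le (leqnSn n) (agree_le (leqnSn n.+1) (agree_doubleS ab)).
rewrite (fn _ _ (agree_succ ab')) (fn _ _ (agree_pred ab')).
by rewrite (fn _ _ (agree_half ab)) (fn _ _ ab2) (fn _ _ ab3).
Qed.

(* With the ratio 3/4, [dual_mean] shrinks the constant, since
   (2 + 4/3 + 2 * 3/4) / 5 = 29/30. *)
Definition holder (L : R) f :=
  forall n a b, agree n a b -> `|f a - f b| <= L * (3 / 4) ^+ n.

Lemma holder_dual_mean L f : holder L f -> holder (29 / 30 * L) (dual_mean f).
Proof.
move=> fL n a b ab; rewrite /dual_mean.
have L0 : 0 <= L.
  have /(fL 0%N) : agree 0 a a by [].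
  by rewrite expr0 mulr1; apply: le_trans.
have h1 := fL _ _ _ (agree_succ ab).
have h2 := fL _ _ _ (agree_pred ab).
have h3 : `|f (dy_half a) - f (dy_half b)| <= L * (3 / 4) ^+ n * (4 / 3).
  case: n ab {h1 h2} => [|n] ab.
    have /(fL 0%N) /= : agree 0 (dy_half a) (dy_half b) by [].
    by rewrite expr0 !mulr1; lra.
  apply: (le_trans (fL _ _ _ (agree_half ab))).
  by rewrite exprS /= le_eqVlt; apply/orP; left; apply/eqP; field.
have h4 := fL _ _ _ (agree_double ab).
have h5 := fL _ _ _ (agree_doubleS ab).
move: h4 h5; rewrite -/(dy_doubleS a) -/(dy_doubleS b) exprS.
move: h1 h2 h3; set t := (3 / 4) ^+ n => h1 h2 h3 h4 h5.
move: h1 h2 h3 h4 h5; rewrite !ler_norml.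
have -> : L * (3 / 4 * t) = L * t * (3 / 4) by ring.
have -> : 29 / 30 * L * t = 29 / 30 * (L * t) by ring.
move: (L * t) => M.
move=> /andP[? ?] /andP[? ?] /andP[? ?] /andP[? ?] /andP[? ?].
by apply/andP; split; lra.
Qed.

(** Points agreeing on n digits have equal values; for m < n common digits, $M \le M (4/3)^{n-m}$
    suffices. *)
Lemma cylindrical_holder n f (M : R) : 0 <= M -> cylindrical n f ->
  (forall x, 0 <= f x <= M) -> holder (M * (4 / 3) ^+ n) f.
Proof.
move=> M0 fn f0M m a b ab.
have [nm|mn] := leqP n m.
  by rewrite (fn a b) ?subrr ?normr0 ?mulr_ge0 ?exprn_ge0//; exact: agree_le ab.
apply: (@le_trans _ _ M).
  by have /andP[? ?] := f0M a; have /andP[? ?] := f0M b; rewrite ler_norml; lra.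
rewrite -mulrA ler_peMr// -(subnK (ltnW mn)) exprD -mulrA -exprMn.
have -> : 4 / 3 * (3 / 4) = 1 :> R by field.
by rewrite expr1n mulr1 exprn_ege1//; lra.
Qed.

Lemma coin_dual_mean_iter k n f : cylindrical n f ->
  cylindrical (k + n) (iter k dual_mean f) /\
  coin (k + n) (iter k dual_mean f) = coin n f.
Proof.
move=> fn; elim: k => [//|k [ck IH]]; split; first exact: cylindrical_dual_mean.
by rewrite addSn iterS coin_dual_mean.
Qed.

Lemma holder_dual_mean_iter k L f :
  holder L f -> holder ((29 / 30) ^+ k * L) (iter k dual_mean f).
Proof.
move=> fL; elim: k => [|k IH]; first by rewrite expr0 mul1r.
by rewrite exprS -mulrA; exact: holder_dual_mean.
Qed.

Lemma holder_coin L n f x : holder L f -> f x <= coin n f + L.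
Proof.
move=> fL; rewrite -lerBlDr -(coin_cst n (f x - L)); apply: coin_le => y.
have /(fL 0%N) : agree 0 x y by [].
by rewrite expr0 mulr1 ler_norml => /andP[_]; rewrite lerBlDr lerBlDl addrC.
Qed.

End fair_coin.

(** * Second moment of $S_n$ under a stationary measure of the dual walk *)

Section law_of_large_numbers.
Variable R : realType.

Definition ZR (z : Z) : R := (int_of_Z z)%:~R.

Lemma ZRD x y : ZR (Z.add x y) = ZR x + ZR y.
Proof. by rewrite /ZR -intrD; congr intmul; lia. Qed.

Lemma ZRM x y : ZR (Z.mul x y) = ZR x * ZR y.
Proof. by rewrite /ZR -intrM; congr intmul; lia. Qed.

Lemma ZRN x : ZR (Z.opp x) = - ZR x.
Proof. by rewrite /ZR -mulrNz; congr intmul; lia. Qed.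

Lemma ZR_nat n : ZR (Z.of_nat n) = n%:R.
Proof. by rewrite /ZR pmulrn; congr intmul; lia. Qed.

Lemma ler_ZR x y : Z.le x y -> ZR x <= ZR y.
Proof. by move=> xy; rewrite ler_int; lia. Qed.

Lemma ZR_abs x : ZR (Z.abs x) = `|ZR x|.
Proof. by rewrite /ZR -intr_norm; congr intmul; lia. Qed.

Lemma cylindrical_sign_sum n : cylindrical n.+1 (sign_sum n).
Proof.
elim: n => [//|n IH] a b ab /=.
rewrite /parity_sign /dy_odd (ab 0%N)// (IH _ _ (agree_half ab)).
by rewrite /dy_half (ab 1%N).
Qed.

(** Flipping the units digit negates $u_0$ and keeps the other signs, so the cross term averages out
    and each place adds 1. *)
Lemma coin_sign_sum_sqr n :
  coin n.+1 (fun x => ZR (sign_sum n x) ^+ 2) = n%:R.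
Proof.
elim: n => [|n IH].
  by under [in LHS]eq_fun do rewrite /sign_sum expr0n; rewrite coin_cst.
rewrite -[LHS]/((coin n.+1 _ + coin n.+1 _) / 2) -coinD mulrC -coinZ.
rewrite -[n.+1%:R]natr1 -IH -[X in _ + X](coin_cst n.+1) -coinD.
congr coin; apply/funext => x.
rewrite /= dy_doubleSK dy_doubleK !ZRD /parity_sign dy_doubleSK odd_succ.
by rewrite /=; case: (dy_odd x); rewrite /= -[ZR 1]/1 -[ZR (-1)]/(-1); field.
Qed.

Local Open Scope ereal_scope.

Lemma integral_dual_mean (rho : probability dyadic R) n (f : dyadic -> R) :
  stationary (@dual_walk R) rho -> cylindrical n f ->
  (forall x, 0 <= f x)%R ->
  \int[rho]_x (f x)%:E = \int[rho]_x (dual_mean f x)%:E.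
Proof.
move=> srho fn f0.
have mf : measurable_fun setT (EFin \o f).
  by apply/measurable_EFinP; exact: measurable_cylindrical fn.
rewrite (integral_stationary srho)//; apply: eq_integral => x _.
rewrite integral_uniform_choice//= /dual_mean.
by rewrite !big_cons big_nil !adde0 -!EFinD -EFinM !addrA.
Qed.

(** Iterating [dual_mean] preserves both the integral against [rho] and the Haar mean, while the
    oscillation is at most $(29/30)^k L$. *)
Lemma integral_coin (rho : probability dyadic R) n (f : dyadic -> R) (M : R) :
  stationary (@dual_walk R) rho -> cylindrical n f ->
  (forall x, 0 <= f x <= M)%R ->
  \int[rho]_x (f x)%:E <= (coin n f)%:E.
Proof.
move=> srho fn f0M.
have M0 : (0 <= M)%R by have /andP[f0 fM] := f0M point; exact: le_trans f0 fM.
have fL := cylindrical_holder M0 fn f0M.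
set L := (M * (4 / 3) ^+ n)%R in fL.
have it0 k : (forall x, 0 <= iter k (@dual_mean R) f x)%R.
  elim: k => [|k IH] x; first by have /andP[] := f0M x.
  by rewrite iterS /dual_mean mulr_ge0// !addr_ge0.
have itE k : \int[rho]_x (f x)%:E = \int[rho]_x (iter k (@dual_mean R) f x)%:E.
  elim: k => [//|k ->].
  by rewrite (integral_dual_mean srho (coin_dual_mean_iter k fn).1).
have le_k k : \int[rho]_x (f x)%:E <= (coin n f + (29 / 30) ^+ k * L)%:E.
  rewrite (itE k) -(coin_dual_mean_iter k fn).2.
  apply: (@le_trans _ _ (\int[rho]_x
      (coin (k + n) (iter k (@dual_mean R) f) + (29 / 30) ^+ k * L)%:E)).
    apply: ge0_le_integral => //.
    - by move=> x _; rewrite lee_fin.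
    - apply/measurable_EFinP; apply: measurable_cylindrical.
      exact: (coin_dual_mean_iter k fn).1.
    - move=> x _; rewrite lee_fin.
      by apply: holder_coin; exact: holder_dual_mean_iter.
  by rewrite integral_probability_cst.
have cvgL :
    (fun k => (coin n f + (29 / 30) ^+ k * L)%:E) @ \oo --> (coin n f)%:E.
  apply: cvg_EFin; first exact: nearW.
  have : (fun k => coin n f + (29 / 30) ^+ k * L)%R @ \oo -->
      (coin n f + 0 * L)%R.
    apply: cvgD; first exact: cvg_cst.
    by apply: cvgMl; apply: cvg_expr; rewrite ger0_norm; lra.
  by rewrite mul0r addr0.
rewrite -(cvg_lim _ cvgL)//; apply: lime_ge.
  by apply/cvg_ex; eexists; exact: cvgL.
by apply: nearW => k; exact: le_k.
Qed.

Lemma integral_sign_sum_sqr (rho : probability dyadic R) n :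
  stationary (@dual_walk R) rho ->
  \int[rho]_x (ZR (sign_sum n x) ^+ 2)%:E <= n%:R%:E.
Proof.
move=> srho; rewrite -(coin_sign_sum_sqr n).
apply: (@integral_coin _ _ _ (n%:R ^+ 2)) => // [a b ab|x].
  by rewrite (cylindrical_sign_sum ab).
rewrite sqr_ge0 /= -real_normK ?num_real// lerXn2r ?nnegrE//.
rewrite -ZR_abs -ZR_nat; apply: ler_ZR.
by have := @sign_sum_bound n x; lia.
Qed.

Definition biased (d : R) n : set dyadic :=
  [set x | (d * n%:R < `|ZR (sign_sum n x)|)%R].

Lemma measurable_biased d n : measurable (biased d n).
Proof.
have mS : measurable_fun setT (fun x => `|ZR (sign_sum n x)|%R).
  by apply: (@measurable_cylindrical _ n.+1) => a b /cylindrical_sign_sum ->.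
have := mS measurableT _ (measurable_itv `]d * n%:R, +oo[%R).
rewrite setTI (_ : _ @^-1` _ = biased d n)//.
by apply/seteqP; split => x /=; rewrite in_itv /= andbT.
Qed.

(** Chebyshev's inequality for $S_n$. *)
Lemma biased_small (rho : probability dyadic R) (d : R) n :
  stationary (@dual_walk R) rho -> (0 < d)%R ->
  (d ^+ 2 * n%:R)%:E * rho (biased d n) <= 1.
Proof.
move=> srho d0.
case: n => [|n]; first by rewrite mulr0 mul0e.
have h : ((d * n.+1%:R) ^+ 2)%:E * rho (biased d n.+1) <= n.+1%:R%:E.
  apply: le_trans (integral_sign_sum_sqr n.+1 srho).
  rewrite -integral_cst; last exact: measurable_biased.
  apply: (@le_trans _ _
      (\int[rho]_(x in biased d n.+1) (ZR (sign_sum n.+1 x) ^+ 2)%:E)).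
    apply: ge0_le_integral.
    - exact: measurable_biased.
    - by move=> x _; rewrite lee_fin sqr_ge0.
    - exact: measurable_cst.
    - apply/measurable_funTS/measurable_EFinP.
      apply: (@measurable_cylindrical _ n.+2) => a b.
      by move=> /cylindrical_sign_sum ->.
    - move=> x /= /ltW xb; rewrite lee_fin -[leRHS]real_normK ?num_real//.
      by rewrite lerXn2r// nnegrE// mulr_ge0// ltW.
  apply: ge0_subset_integral => //.
  - exact: measurable_biased.
  - apply/measurable_EFinP.
    by apply: (@measurable_cylindrical _ n.+2) => a b /cylindrical_sign_sum ->.
  - by move=> x _; rewrite lee_fin sqr_ge0.
have n0 : (0 < n.+1%:R :> R)%R by [].
rewrite -(@lee_pmul2l _ n.+1%:R%:E)// mule1.
apply: le_trans h; rewrite muleA -EFinM exprMn.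
by rewrite expr2 (expr2 n.+1%:R) mulrCA mulrA.
Qed.

End law_of_large_numbers.

(** * Drift of the graph walk *)

Section absolute_continuity.
Context d (T : measurableType d) (R : realType).
Implicit Types mu rho : probability T R.
Local Open Scope ereal_scope.

(** The epsilon-delta form of absolute continuity, obtained by viewing [mu] as a charge, whose
    variation bounds [mu]. *)
Lemma null_dominates_continuous mu rho (e : R) : mu `<< rho -> (0 < e)%R ->
  exists2 r : R, (0 < r)%R &
    forall A, measurable A -> rho A < r%:E -> mu A < e%:E.
Proof.
move=> murho e0.
pose nu := [the charge _ _ of charge_of_finite_measure mu].
have [P [N nuPN]] := Hahn_decomposition nu.
have [r [r0 hr]] :=
  @charge_variation_continuous _ _ _ nu _ _ nuPN rho murho e e0.
exists r => // A mA rhoA; apply: le_lt_trans (hr A mA rhoA).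
by apply: le_trans (abse_charge_variation nuPN mA); exact: lee_abs.
Qed.

End absolute_continuity.

Section graph_drift.
Variable R : realType.
Local Open Scope ereal_scope.

(** At most four faces meet the root and one carries its label, so the induced measure is at least
    [mu] / 4. *)
Lemma induced_dual_dominates (mu : probability dyadic R) :
  mu `<< induced_dual mu.
Proof.
apply/null_content_dominatesP => A mA indA0.
apply/eqP; rewrite eq_le measure_ge0 andbT.
have : \int[mu]_x (4^-1%:E * (\1_A x)%:E) <= 0.
  rewrite -indA0; apply: ge0_le_integral => //.
  - apply: measurable_funeM; apply/measurable_EFinP.
    exact: measurable_indic.
  - exact: (measurable_kernel (@random_face R) A mA).
  - move=> x _; rewrite /= /uniform_choice /incident_faces.
    have le_choice (c : R) s : (4^-1 <= c)%R ->
        4^-1%:E * (\1_A x)%:E <= c%:E * (\d_x A + \sum_(y <- s) \d_y A).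
      move=> c4; apply: lee_pmul; rewrite ?lee_fin ?invr_ge0//.
      by rewrite leeDl// sume_ge0.
    by case: ifP => _; rewrite big_cons /=; apply: le_choice; lra.
rewrite ge0_integralZl//; last first.
  by apply/measurable_EFinP; exact: measurable_indic.
by rewrite integral_indic// setIT pmule_rle0// lte_fin.
Qed.

Lemma cylindrical_bounded n (f : dyadic -> R) : cylindrical n f ->
  exists M : R, forall x, (`|f x| <= M)%R.
Proof.
elim: n f => [|n IH] f fn.
  by exists `|f point|%R => x; rewrite (fn x point).
have [M1 h1] := IH _ (cylindrical_double fn).
have [M2 h2] := IH _ (cylindrical_doubleS fn).
exists (Num.max M1 M2) => x; rewrite (dy_oddK x) le_max.
by case: ifP => _; [rewrite (h2 _) orbT|rewrite (h1 _)].
Qed.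

Lemma teval_cylindrical t : exists n, cylindrical n (teval t).
Proof.
elim: t => [z|l [m lm] r [n rn]]; first by exists 0%N.
exists (maxn m n).+1 => a b ab /=.
rewrite /dy_odd (ab 0%N)//; have ab' := agree_half ab.
case: ifP => _; [apply: rn|apply: lm].
  by apply: agree_le ab'; exact: leq_maxr.
by apply: agree_le ab'; exact: leq_maxl.
Qed.

Lemma test_sum_cylindrical n : exists m, cylindrical m (test_sum n).
Proof.
have [p hp] := teval_cylindrical potential_trie.
elim: n => [|n [m hm]]; first by exists 0%N.
exists (m + p + (13 + n).+2)%N => a b ab; rewrite !test_sumS.
congr (Z.add (Z.add _ _) (Z.mul _ _)).
- by apply: hm; apply: agree_le ab; lia.
- by apply: hp; apply: agree_le ab; lia.
- have ab' : agree (13 + n).+2 a b by apply: agree_le ab; lia.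
  rewrite /sym_sum (cylindrical_sign_sum ab').
  by rewrite (cylindrical_sign_sum (agree_pred ab')).
Qed.

Definition graph_mean (f : dyadic -> R) x : R :=
  (\sum_(y <- graph_neighbours x) f y) / (size (graph_neighbours x))%:R.

(** Dividing [test_sum_drift] by the degree 3 or 4 leaves a gain of at least n / 4 and can only
    shrink the error. *)
Lemma test_sum_mean n x (c : R) :
  (ZR R (test_sum n x) + c + n%:R / 4 <=
   graph_mean (fun y => ZR R (test_sum n y) + c) x
     + (ZR R 30000 + ZR R 2000 * `|ZR R (sign_sum (13 + n) x)|))%R.
Proof.
have /(ler_ZR R) := @test_sum_drift n x; move: (sign_sum (13 + n) x) => S.
rewrite /degree /neighbour_sum /graph_mean /graph_neighbours.
rewrite !ZRD ZRN ZRD !ZRM ZR_abs ZR_nat.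
have : (0 <= ZR R 30000)%R by apply: (@ler_ZR R 0).
have : (0 <= ZR R 2000 * `|ZR R S|)%R.
  by rewrite mulr_ge0//; apply: (@ler_ZR R 0).
have : (0 <= n%:R :> R)%R by [].
move: (ZR R 30000) (ZR R 2000 * `|ZR R S|)%R => k s n0 s0 k0.
case: (dy_odd x); rewrite !big_cons big_nil /=.
  have -> : ZR R 3 = 3%R by [].
  have -> : ZR R 0 = 0%R by [].
  move=> h; lra.
have -> : ZR R 4 = 4%R by [].
move=> h; lra.
Qed.

Lemma integral_graph_walk (f : dyadic -> R) x :
  (forall y, 0 <= f y)%R -> measurable_fun setT f ->
  \int[graph_walk R x]_y (f y)%:E = (graph_mean f x)%:E.
Proof.
move=> f0 mf; rewrite integral_uniform_choice//; last exact/measurable_EFinP.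
by rewrite sumEFin -EFinM mulrC.
Qed.

(** Stationarity cancels the test function. With N = 13 + n, $|S_N|$ is at most eN off the biased
    set and at most N on it, a set of mass below e; hence the mean bound 2eN. *)
Lemma drift_le_bias (mu : probability dyadic R) n (e : R) : (0 < e)%R ->
  stationary (@graph_walk R) mu -> mu (biased e (13 + n)) < e%:E ->
  (n%:R / 4 <= ZR R 30000 + ZR R 2000 * (2 * e * (13 + n)%:R))%R.
Proof.
move=> e0 smu; set A := biased e (13 + n) => muA.
have mA : measurable A by exact: measurable_biased.
have [m hm] := test_sum_cylindrical n.
have cT : cylindrical m (fun y => ZR R (test_sum n y)) by move=> a b /hm ->.
have [M hM] := cylindrical_bounded cT.
(* The shift makes the test function nonnegative, as [integral_stationary] requires. *)
pose G y := (ZR R (test_sum n y) + M)%R.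
have G0 y : (0 <= G y)%R.
  by have := hM y; rewrite ler_norml /G => /andP[? _]; lra.
have GM y : (G y <= M + M)%R.
  by have := hM y; rewrite ler_norml /G => /andP[_ ?]; lra.
have mG : measurable_fun setT G.
  by apply: (@measurable_cylindrical _ m) => a b /cT; rewrite /G => ->.
have mGE : measurable_fun setT (EFin \o G) by exact/measurable_EFinP.
pose k0 := ZR R 30000; pose k1 := ZR R 2000.
have k00 : (0 <= k0)%R by exact: (@ler_ZR R 0).
have k10 : (0 <= k1)%R by exact: (@ler_ZR R 0).
pose N : R := (13 + n)%:R.
have N0 : (0 <= N)%R by [].
have stepG x : (G x)%:E + (n%:R / 4)%:E <=
    \int[graph_walk R x]_y (G y)%:E
      + ((k0 + k1 * (e * N))%:E + (k1 * N)%:E * (\1_A x)%:E).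
  rewrite integral_graph_walk// -EFinM -!EFinD lee_fin.
  apply: le_trans (test_sum_mean n x M) _.
  apply: lerD => //.
  rewrite -/k0 -/k1 -(addrA k0) lerD2l -(mulrA k1) -mulrDr ler_wpM2l//.
  rewrite indicE; have [/set_mem xA|xA] := boolP (x \in A).
    rewrite mulr1 -[leLHS]add0r lerD//; first by rewrite mulr_ge0// ltW.
    rewrite -ZR_abs /N -ZR_nat; apply: ler_ZR.
    by have := @sign_sum_bound (13 + n) x; lia.
  rewrite mulr0 addr0 leNgt; apply/negP => h.
  by move/negP: xA; apply; apply/mem_set.
have mI : measurable_fun setT (fun x => (\1_A x : R)%:E).
  by apply/measurable_EFinP; exact: measurable_indic.
have mkI : measurable_fun setT (fun x => (k1 * N)%:E * (\1_A x : R)%:E).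
  exact: measurable_funeM.
have mJ : measurable_fun setT (fun x => \int[graph_walk R x]_y (G y)%:E).
  apply: measurable_fun_integral_kernel => //.
  by move=> U mU; exact: (measurable_kernel (@graph_walk R)).
have J0 x : setT x -> 0 <= \int[graph_walk R x]_y (G y)%:E.
  by move=> _; apply: integral_ge0 => y _; rewrite lee_fin.
have G0E x : setT x -> 0 <= (G x)%:E by rewrite lee_fin.
have kI0 x : setT x -> 0 <= (k1 * N)%:E * (\1_A x : R)%:E.
  by move=> _; rewrite mule_ge0// lee_fin// mulr_ge0.
have b0 : (0 <= k0 + k1 * (e * N))%R by rewrite addr_ge0// !mulr_ge0// ltW.
have bkI0 x : setT x ->
    0 <= (k0 + k1 * (e * N))%:E + (k1 * N)%:E * (\1_A x : R)%:E.
  by move=> xT; apply: adde_ge0; [rewrite lee_fin|exact: kI0].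
have : \int[mu]_x ((G x)%:E + (n%:R / 4)%:E) <=
    \int[mu]_x (\int[graph_walk R x]_y (G y)%:E
       + ((k0 + k1 * (e * N))%:E + (k1 * N)%:E * (\1_A x)%:E)).
  apply: ge0_le_integral => //.
  - by move=> x _; rewrite adde_ge0// lee_fin// divr_ge0.
  - exact: emeasurable_funD.
  - by apply: emeasurable_funD; last exact: emeasurable_funD.
rewrite ge0_integralD// [leRHS]ge0_integralD//; last exact: emeasurable_funD.
rewrite -(integral_stationary smu)//.
(* Finiteness permits cancelling this integral from both sides. *)
have IG : \int[mu]_x (G x)%:E \is a fin_num.
  rewrite ge0_fin_numE; last by apply: integral_ge0 => x _; rewrite lee_fin.
  apply: (@le_lt_trans _ _ (\int[mu]_x (M + M)%:E)).
    by apply: ge0_le_integral => // x _; rewrite lee_fin.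
  by rewrite integral_probability_cst ltry.
rewrite leeD2lE// ge0_integralD// ge0_integralZl//; last exact: mulr_ge0.
rewrite integral_indic// setIT !integral_probability_cst => h.
have : (n%:R / 4)%:E <= (k0 + k1 * (e * N))%:E + (k1 * N)%:E * e%:E.
  by apply: le_trans h _; rewrite leeD2l// lee_pmul2l// ?ltW// lte_fin mulr_gt0.
rewrite -EFinM -EFinD lee_fin => /le_trans; apply.
by rewrite -/k0 -/k1 -/N -subr_ge0 [leRHS](_ : _ = 0%R)//; ring.
Qed.

End graph_drift.

Theorem theorem4p19 (R : realType) (mu rho : probability dyadic R) :
  stationary (@graph_walk R) mu -> stationary (@dual_walk R) rho ->
  ~ (induced_dual mu `<< rho).
Proof.
move=> smu srho ac.
have murho := null_dominates_trans (@induced_dual_dominates R mu) ac.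
pose k0 := ZR R 30000; pose k1 := ZR R 2000.
have k10 : (0 < k1)%R by apply: lt_le_trans (@ler_ZR R 1 2000 _).
(* Chosen so that $2 e k_1 (13 + n) = (13 + n)/8$, which grows more slowly than n / 4. *)
pose e : R := (16 * k1)^-1%R.
have e0 : (0 < e)%R by rewrite invr_gt0 mulr_gt0.
have [r r0 small] := null_dominates_continuous murho e0.
(* The first two terms make $n/4 \le k_0 + (13 + n)/8$ fail; the last one brings Chebyshev's bound
   on the biased set below r. *)
pose n := (Num.truncn (8 * k0 + 13 + (e ^+ 2 * r)^-1)).+1.
have nlt : (8 * k0 + 13 + (e ^+ 2 * r)^-1 < n%:R)%R by exact: truncnS_gt.
have er0 : (0 < e ^+ 2 * r)%R by rewrite mulr_gt0// exprn_gt0.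
have k00 : (0 <= k0)%R by exact: (@ler_ZR R 0).
have /small : measurable (biased e (13 + n)) by exact: measurable_biased.
have N0 : ((13 + n)%:R = 13 + n%:R :> R)%R by rewrite natrD.
move=> /(_ _)/(drift_le_bias e0 smu) h.
have {}h : (n%:R / 4 <= k0 + k1 * (2 * e * (13 + n)%:R))%R.
  apply: h; rewrite ltNge; apply/negP => rA.
  have := biased_small (13 + n) srho e0; apply/negP; rewrite -ltNge.
  apply: (@lt_le_trans _ _ (e ^+ 2 * (13 + n)%:R * r)%:E).
    rewrite lte_fin mulrAC -ltr_pdivrMl// mulr1 N0.
    by apply: le_lt_trans (lt_trans nlt _); lra.
  by rewrite EFinM lee_pmul2l// lte_fin mulr_gt0 ?exprn_gt0// N0; lra.
have k1e : (k1 * (2 * e * (13 + n)%:R) = (13 + n%:R) / 8)%R.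
  have -> : (k1 * (2 * e * (13 + n)%:R) = k1 * e * (2 * (13 + n)%:R))%R by ring.
  have -> : (k1 * e = 16^-1)%R.
    by rewrite /e invfM mulrCA divff ?mulr1 ?lt0r_neq0.
  by rewrite N0; lra.
have einv : (0 < (e ^+ 2 * r)^-1)%R by rewrite invr_gt0.
by move: h; rewrite k1e; lra.
Qed.
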